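(* Fix $\nu>0$, and let $T_0$ be a positive random variable with density $f_{T_0}$, cumulant function $\psi(s):=-\log\mathbb{E}[e^{-sT_0}]$, and $\mathbb{E}[T_0^{-\nu}]<\infty$. Let $\xi$ and $T$ be positive, absolutely continuous random variables (defined on a common probability space). Then the three properties (i) $T$ and $\xi T$ are stochastically independent, (ii) $\xi T$ has the $\mathrm{Gamma}(\nu,1)$ distribution, (iii) $T$ is equal in distribution to $T_0^{[\nu]}$, all hold if and only if the pair $(T,\xi)$ satisfies $$\mathbb{P}(\xi\in ds)=\frac{e^{-\psi(s)}s^{\nu-1}}{\mathbb{E}[T_0^{-\nu}]\,\Gamma(\nu)}\,ds\quad (s>0)\qquad\text{and}\qquad T\,|\,(\xi=s)\ \overset{d}{=}\ T_0^{(s)}\ \text{ for almost every } s>0.$$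
   Context: For a non-negative random variable $T_0$ with density $f_{T_0}$ and cumulant function $\psi(s)=-\log\mathbb{E}[e^{-sT_0}]$: for $s\ge 0$, the exponentially tilted variable $T_0^{(s)}$ is a random variable with law $\mathbb{P}(T_0^{(s)}\in dt)=e^{-st+\psi(s)}f_{T_0}(t)\,dt$; for $\nu>0$ with $\mathbb{E}[T_0^{-\nu}]<\infty$, the polynomially tilted variable $T_0^{[\nu]}$ is a random variable with law $\mathbb{P}(T_0^{[\nu]}\in dt)=\frac{t^{-\nu}}{\mathbb{E}[T_0^{-\nu}]}f_{T_0}(t)\,dt$. $T\,|\,(\xi=s)$ denotes the regular conditional law of $T$ given $\xi=s$. $\mathrm{Gamma}(\nu,1)$ has density $t^{\nu-1}e^{-t}/\Gamma(\nu)$ on $(0,\infty)$. *)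

(* Defs.v *)
From HB Require Import structures.
From mathcomp Require Import all_boot all_order all_algebra.
From mathcomp Require Import all_classical all_reals all_analysis measurable_realfun.

Set Implicit Arguments.
Unset Strict Implicit.
Unset Printing Implicit Defensive.

Import Order.TTheory GRing.Theory Num.Theory.
Import numFieldNormedType.Exports.

Local Open Scope classical_set_scope.
Local Open Scope ring_scope.

Section laws.
Context {R : realType}.

Definition has_density (mu : {measure set R -> \bar R}) (f : R -> R) : Prop :=
  [/\ measurable_fun [set: R] f,
      (forall x, 0 <= f x) &
      forall B : set R, measurable B ->
        mu B = (\int[lebesgue_measure]_(x in B) (f x)%:E)%E].

Definition Gamma_fun (nu : R) : R :=
  \int[lebesgue_measure]_(x in `]0, +oo[) (x `^ (nu - 1) * expR (- x)).

Definition Gamma_pdf (nu : R) : R -> R :=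
  (fun x => x `^ (nu - 1) * expR (- x) / Gamma_fun nu) \_ `]0, +oo[.

Section random_variables.
Context d {Omega : measurableType d} (P : probability Omega R).

Definition positive_rv (X : {RV P >-> R}) : Prop := {ae P, forall w, 0 < X w}.

Definition abs_continuous_rv (X : {RV P >-> R}) : Prop :=
  distribution P X `<< lebesgue_measure.

Definition independent_rv (X Y : {RV P >-> R}) : Prop :=
  forall A B : set R, measurable A -> measurable B ->
    P (X @^-1` A `&` Y @^-1` B) = (P (X @^-1` A) * P (Y @^-1` B))%E.

(* [kappa] is a version of the regular conditional law of [Y] given [X]; such
   a kernel is only determined up to a null set of the law of [X]. *)
Definition regular_conditional_law (Y X : {RV P >-> R})
    (kappa : R.-pker R ~> R) : Prop :=
  forall A B : set R, measurable A -> measurable B ->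
    P (X @^-1` A `&` Y @^-1` B) =
    (\int[distribution P X]_(s in A) kappa s B)%E.

(* Only used for [X] almost surely positive and [0 <= s], where the expectation
   is in ]0, 1], so that [fine] and [ln] are not applied to junk values. *)
Definition cumulant (X : {RV P >-> R}) (s : R) : R :=
  - ln (fine 'E_P[fun w => expR (- s * X w)]).

(* Valued in [\bar R], since it may be infinite. *)
Definition neg_moment (X : {RV P >-> R}) (nu : R) : \bar R :=
  'E_P[fun w => X w `^ (- nu)].

(* In the next two definitions [f] is meant to be a density of [X]; when [X] is
   almost surely positive, [f] vanishes almost everywhere on the half-line
   where [t <= 0], so the conventional values of [t `^ (- nu)] there do not
   matter. *)
Definition exp_tilt_pdf (X : {RV P >-> R}) (f : R -> R) (s t : R) : R :=
  expR (- s * t + cumulant X s) * f t.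

Definition poly_tilt_pdf (X : {RV P >-> R}) (f : R -> R) (nu t : R) : R :=
  t `^ (- nu) / fine (neg_moment X nu) * f t.

Definition mixing_pdf (X : {RV P >-> R}) (nu : R) : R -> R :=
  (fun s => expR (- cumulant X s) * s `^ (nu - 1) /
            (fine (neg_moment X nu) * Gamma_fun nu)) \_ `]0, +oo[.

End random_variables.
End laws.

(* Main.v *)
Require Import Defs.
From HB Require Import structures.
From mathcomp Require Import all_boot all_order all_algebra.
From mathcomp Require Import all_classical all_reals all_analysis measurable_realfun.
From mathcomp Require Import ring.

(** The whole theorem is a computation of the law of the pair [(xi, T)]. Both
    sides of the equivalence say that this law has the density
    [s `^ (nu - 1) * expR (- s * t) * f t] on the positive quadrant, up to the
    normalising constant [E[T0 ^ (- nu)] * Gamma_fun nu].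

    Properties (i)-(iii) say that [(T, xi * T)] follows the product of the
    polynomially tilted law and the Gamma law. The map
    [(t, y) |-> (y / t, t)] ([ratio]) turns [(T, xi * T)] into [(xi, T)], is
    invertible for [0 < t], with an inverse of Jacobian [t]; the resulting density
    is the product of the mixing density and of the exponential tilt
    ([Gamma_poly_tiltE]). In integrated form this is [mixture_identity], and
    [product_ratio] reads it as the value on rectangles of the image by [ratio]
    of the product law. On the other side, a mixing density together with a
    conditional law prescribes exactly the values on rectangles
    [P (xi \in A, T \in B)].

    The pivot is therefore the formula [has_tilted_joint] for these values.
    It follows from independence ([independent_tilted_joint]) and from the
    conditional description ([conditional_tilted_joint]). Conversely it gives
    the conditional description, because the exponential tilts are probability
    densities ([integral_exp_tilt]), and it gives independence, because a law on
    the plane is determined by its values on rectangles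
    ([tilted_joint_product]). *)

Set Implicit Arguments.
Unset Strict Implicit.
Unset Printing Implicit Defensive.

Import Order.TTheory GRing.Theory Num.Theory.
Import numFieldNormedType.Exports.

Local Open Scope classical_set_scope.
Local Open Scope ring_scope.

(** * Integration against Lebesgue measure and densities *)

Section lebesgue_integral.
Context {R : realType}.
Local Notation leb := (@lebesgue_measure R).

Lemma preimage_mulr_itvoc (t a b : R) : 0 < t ->
  *%R t @^-1` `]a, b] = `]a / t, b / t]%classic.
Proof.
move=> t0; apply/seteqP; split => x /=; rewrite !in_itv/= => /andP[ax xb].
  by rewrite ltr_pdivrMr// ler_pdivlMr// ![x * t]mulrC ax.
by move: ax xb; rewrite ltr_pdivrMr// ler_pdivlMr// ![x * t]mulrC => -> ->.
Qed.

(** Multiplied by [t], the push-forward of Lebesgue measure by [s |-> t * s]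
    agrees with Lebesgue measure on half-open intervals, hence on all Borel
    sets. *)
Lemma ge0_integral_scale (t : R) (g : R -> \bar R) : 0 < t ->
  measurable_fun [set: R] g -> (forall x, 0 <= g x)%E ->
  (\int[leb]_y g y = t%:E * \int[leb]_s g (t * s)%R)%E.
Proof.
move=> t0 mg g0.
have mt : measurable_fun [set: measurableTypeR R]
    ( *%R t : R -> measurableTypeR R).
  exact: measurable_funM.
pose tt : {nonneg R} := NngNum (ltW t0).
(* [m0] is a function of the measurability proof of the map. *)
pose m0 := pushforward leb ( *%R t : measurableTypeR R -> measurableTypeR R)
  : {measure set (measurableTypeR R) -> \bar R}.
pose m := m0 mt.
have E A : measurable A -> leb A = mscale tt m A.
  apply: lebesgue_measure_unique => X [[a b]] _ <-.
  rewrite /=; transitivity (t%:E * leb ( *%R t @^-1` `]a, b]))%E; last by [].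
  rewrite preimage_mulr_itvoc//.
  rewrite !lebesgue_measure_itv/= !lte_fin ltr_pM2r ?invr_gt0//.
  case: ifP => _; last by rewrite mule0.
  rewrite -EFinM; congr EFin; rewrite -mulrBl mulrCA mulfV ?mulr1//.
  by rewrite gt_eqF.
rewrite (eq_measure_integral (mscale tt m)); last by move=> A mA _; exact: E.
rewrite ge0_integral_mscale//=; congr (_ * _)%E.
by rewrite ge0_integral_pushforward.
Qed.

(** Tonelli's theorem on a rectangle: the indicators of the two sides are moved
    into the integrand. *)
Lemma ge0_integral_exchange (A B : set R) (h : R -> R -> \bar R) :
  measurable A -> measurable B ->
  measurable_fun [set: R * R] (fun z => h z.1 z.2) ->
  (forall x y, 0 <= h x y)%E ->
  (\int[leb]_(x in A) \int[leb]_(y in B) h x y =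
   \int[leb]_(y in B) \int[leb]_(x in A) h x y)%E.
Proof.
move=> mA mB mh h0.
pose k (z : R * R) := (h z.1 z.2 * (\1_A z.1)%:E * (\1_B z.2)%:E)%E.
have mk : measurable_fun [set: R * R] k.
  apply: emeasurable_funM; first apply: emeasurable_funM => //.
    by apply/measurable_EFinP; apply: (measurableT_comp (measurable_indic mA)).
  by apply/measurable_EFinP; apply: (measurableT_comp (measurable_indic mB)).
have k0 z : (0 <= k z)%E by rewrite /k !mule_ge0// lee_fin.
transitivity (\int[leb]_x \int[leb]_y k (x, y))%E.
  rewrite [LHS]integral_mkcond; apply: eq_integral => x _.
  rewrite patchE; case: ifPn => xA.
    rewrite integral_mkcond; apply: eq_integral => y _.
    by rewrite patchE /k/= !indicE xA mule1; case: ifPn; rewrite ?mule1 ?mule0.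
  by rewrite integral0_eq// => y _; rewrite /k/= indicE (negbTE xA) mule0 mul0e.
transitivity (\int[leb]_y \int[leb]_x k (x, y))%E; first exact: fubini_tonelli.
symmetry; rewrite [LHS]integral_mkcond; apply: eq_integral => y _.
rewrite patchE; case: ifPn => yB.
  rewrite integral_mkcond; apply: eq_integral => x _.
  by rewrite patchE /k/= !indicE yB mule1; case: ifPn; rewrite ?mule1 ?mule0.
by rewrite integral0_eq// => x _; rewrite /k/= !indicE (negbTE yB) mule0.
Qed.

Lemma measurable_fun_ge0_integral (B : set R) (h : R -> R -> \bar R) :
  measurable B ->
  measurable_fun [set: R * R] (fun z => h z.1 z.2) ->
  (forall x y, 0 <= h x y)%E ->
  measurable_fun [set: R] (fun x => \int[leb]_(y in B) h x y)%E.
Proof.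
move=> mB mh h0.
have -> : (fun x => \int[leb]_(y in B) h x y)%E =
    fubini_F leb (fun z => h z.1 z.2 * (\1_B z.2)%:E)%E.
  apply/funext => x; rewrite /fubini_F/= integral_mkcond.
  apply: eq_integral => y _.
  by rewrite patchE indicE; case: ifPn; rewrite ?mule1 ?mule0.
apply: measurable_fun_fubini_tonelli_F.
  apply: emeasurable_funM => //.
  by apply/measurable_EFinP; apply: (measurableT_comp (measurable_indic mB)).
by move=> z; rewrite mule_ge0// lee_fin.
Qed.

Lemma has_density_dominates (mu : {measure set R -> \bar R}) (f : R -> R) :
  has_density mu f -> mu `<< leb.
Proof.
move=> [mf f0 muE]; apply/null_content_dominatesP => A mA A0.
rewrite muE// (ge0_ae_eq_integral (g := cst 0%E)) ?integral0//.
- exact/measurable_EFinP/measurable_funTS.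
- by move=> x _; rewrite lee_fin.
- by exists A; split => // x /= /not_implyP[].
Qed.

(** The given density agrees almost everywhere with the Radon-Nikodym
    derivative, for which this change of measure is known. *)
Lemma ge0_integral_has_density (mu : probability R R) (f : R -> R)
    (E : set R) (g : R -> \bar R) :
  has_density mu f -> measurable E ->
  measurable_fun [set: R] g -> (forall x, 0 <= g x)%E ->
  (\int[mu]_(x in E) g x = \int[leb]_(x in E) (g x * (f x)%:E))%E.
Proof.
move=> dmu mE mg g0; have [mf f0 muE] := dmu.
(* Lebesgue measure is declared on [measurableTypeR R] and [mu] on [R]: the same
   measurable sets, but distinct structures. The law of the identity carries
   [mu] from one to the other. *)
have mid : measurable_fun [set: R] (idfun : R -> measurableTypeR R).
  by move=> _ Y mY; rewrite setTI.
pose X : {mfun R >-> measurableTypeR R} := HB.pack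
  (idfun : R -> measurableTypeR R) (isMeasurableFun.Build _ _ _ _ _ mid).
pose nu := distribution mu X.
have nu_leb : nu `<< leb := has_density_dominates dmu.
transitivity (\int[nu]_(x in E) g x)%E.
  by rewrite ge0_integral_pushforward//; exact: measurable_funTS.
rewrite -(Radon_Nikodym_SigmaFinite.change_of_variables nu_leb)//; last first.
  exact: measurable_funTS.
have mRN : measurable_fun setT (Radon_Nikodym_SigmaFinite.f nu leb).
  exact: measurable_int (Radon_Nikodym_SigmaFinite.f_integrable nu_leb).
have RNE : ae_eq leb setT (Radon_Nikodym_SigmaFinite.f nu leb) (EFin \o f).
  apply: integral_ae_eq => //.
  - exact: Radon_Nikodym_SigmaFinite.f_integrable.
  - exact/measurable_EFinP.
  - move=> A _ mA; rewrite -Radon_Nikodym_SigmaFinite.f_integral//.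
    exact: muE.
apply: ge0_ae_eq_integral => //.
- by apply: emeasurable_funM; apply: measurable_funTS.
- apply: emeasurable_funM; apply: measurable_funTS => //.
  exact/measurable_EFinP.
- by move=> x _; rewrite mule_ge0// Radon_Nikodym_SigmaFinite.f_ge0.
- by move=> x _; rewrite mule_ge0// lee_fin.
- by apply: filterS RNE => x /(_ I) /= -> _.
Qed.

End lebesgue_integral.

(** * Laws and kernels with prescribed densities *)

Section density_law.
Context {R : realType} (f : R -> R).
Local Notation leb := (@lebesgue_measure R).
Context (mf : measurable_fun [set: R] f) (f0 : forall x, 0 <= f x)
  (f1 : (\int[leb]_x (f x)%:E = 1)%E).

Definition density_law (A : set R) : \bar R := (\int[leb]_(x in A) (f x)%:E)%E.

Let density_law0 : density_law set0 = 0%E.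
Proof. by rewrite /density_law integral_set0. Qed.

Let density_law_ge0 A : (0 <= density_law A)%E.
Proof. by apply: integral_ge0 => x _; rewrite lee_fin. Qed.

Let density_law_sigma_additive : semi_sigma_additive density_law.
Proof.
move=> F mF tF mUF; rewrite /density_law ge0_integral_bigcup//=.
- apply: is_cvg_nneseries => n _ _.
  by apply: integral_ge0 => x _; rewrite lee_fin.
- exact/measurable_EFinP/measurable_funTS.
- by move=> x _; rewrite lee_fin.
Qed.

HB.instance Definition _ := isMeasure.Build _ _ _ density_law
  density_law0 density_law_ge0 density_law_sigma_additive.

Let density_law_setT : density_law setT = 1%E.
Proof. exact: f1. Qed.

HB.instance Definition _ :=
  Measure_isProbability.Build _ _ _ density_law density_law_setT.

Lemma exists_probability_density :
  exists mu : probability R R, has_density mu f.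
Proof. by exists density_law. Qed.

End density_law.

Section prob_kernel.
Context {R : realType} (mu : R -> probability R R).
Context (mmu : forall U : set R, measurable U ->
  measurable_fun [set: R] (fun s => mu s U)).

(** The values are recast as plain measures, as in the type of a kernel. *)
Definition probability_family (s : R) : {measure set R -> \bar R} := mu s.

HB.instance Definition _ :=
  @isKernel.Build _ _ R R R probability_family mmu.

Let probability_family_setT s : probability_family s [set: R] = 1%E.
Proof. by rewrite /probability_family/= probability_setT. Qed.

HB.instance Definition _ :=
  @Kernel_isProbability.Build _ _ R R R
    probability_family probability_family_setT.

Lemma probability_family_kernel : exists kappa : R.-pker R ~> R,
  forall s U, kappa s U = mu s U.
Proof. by exists probability_family. Qed.

End prob_kernel.

Lemma exists_density_kernel {R : realType} (h : R -> R -> R) :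
  measurable_fun [set: R * R] (fun z => h z.1 z.2) ->
  (forall x y, 0 <= h x y) ->
  (forall x, \int[lebesgue_measure]_y (h x y)%:E = 1)%E ->
  exists kappa : R.-pker R ~> R, forall s, has_density (kappa s) (h s).
Proof.
move=> mh h0 h1.
have mhs s : measurable_fun [set: R] (h s).
  exact: (measurableT_comp mh (pair1_measurable s)).
have /choice[mu muE] (s : R) :
    exists mu : probability R R, has_density mu (h s).
  exact: exists_probability_density.
have [|kappa kappaE] := @probability_family_kernel R mu.
  move=> U mU.
  have -> : (fun s => mu s U) =
      (fun s => \int[lebesgue_measure]_(t in U) (h s t)%:E)%E.
    by apply/funext => s; have [_ _ ->] := muE s.
  apply: (measurable_fun_ge0_integral (h := fun x y => (h x y)%:E)) => //.
  exact/measurable_EFinP.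
exists kappa => s; split => // B mB.
by rewrite kappaE; have [_ _ ->] := muE s.
Qed.

(** * Exponential tilts *)

Section tilt.
Context {R : realType} (d0 : measure_display) (Omega0 : measurableType d0)
  (P0 : probability Omega0 R) (T0 : {RV P0 >-> R}).
Local Notation leb := (@lebesgue_measure R).

Definition laplace (s : R) : \bar R := 'E_P0[fun w => expR (- s * T0 w)].

Lemma measurable_expRM : measurable_fun [set: R * R]
  (fun z => expR (- z.1 * z.2)).
Proof.
apply: measurableT_comp => //; apply: measurable_funM => //.
exact: measurableT_comp.
Qed.

Lemma measurable_laplace : measurable_fun [set: R] laplace.
Proof.
have -> : laplace = fubini_F P0 (fun z : R * Omega0 =>
    (expR (- z.1 * T0 z.2))%:E).
  by apply/funext => s; rewrite /laplace unlock.
apply: measurable_fun_fubini_tonelli_F; last first.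
  by move=> z; rewrite lee_fin expR_ge0.
apply/measurable_EFinP.
apply: (measurableT_comp measurable_expRM
  (g := fun z : R * Omega0 => (z.1, T0 z.2))).
by apply: measurable_fun_pair => //; exact: measurableT_comp.
Qed.

Lemma measurable_cumulant : measurable_fun [set: R] (cumulant T0).
Proof.
have -> : cumulant T0 = -%R \o (@ln R \o (fine \o laplace)) by [].
do 2 apply: measurableT_comp => //.
by apply: measurableT_comp measurable_laplace; exact: fine_measurable.
Qed.

Context (hT0 : positive_rv T0).

(** A non-negative function with zero integral vanishes almost everywhere, and
    the exponential vanishes nowhere. *)
Lemma laplace_gt0 s : (0 < laplace s)%E.
Proof.
rewrite /laplace unlock lt_neqAle; apply/andP; split; last first.
  by apply: integral_ge0 => w _; rewrite lee_fin expR_ge0.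
apply/eqP => /esym I0.
have mg : measurable_fun [set: Omega0] (fun w => (expR (- s * T0 w))%:E).
  apply/measurable_EFinP; apply: measurableT_comp => //.
  exact: measurable_funM.
have := ae_eq_integral_abs P0 measurableT mg.
under eq_integral do rewrite gee0_abs ?lee_fin ?expR_ge0//.
move=> [/(_ I0)[N [mN N0 subN]] _].
have P00 : P0 [set: Omega0] = 0%E.
  apply: (subset_measure0 _ _ _ N0) => //; apply: subset_trans subN => w _ /=.
  by move=> /(_ I)/eqP; rewrite eqe gt_eqF ?expR_gt0.
by move: (probability_setT P0); rewrite P00 => /eqP; rewrite eq_sym onee_eq0.
Qed.

Lemma laplace_le1 s : 0 <= s -> (laplace s <= 1)%E.
Proof.
move=> s0; rewrite /laplace unlock.
have mg : measurable_fun [set: Omega0] (fun w => (expR (- s * T0 w))%:E).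
  apply/measurable_EFinP; apply: measurableT_comp => //.
  exact: measurable_funM.
have -> : 1%E = (\int[P0]_w cst 1 w)%E.
  by rewrite integral_cst// mul1e; exact/esym/probability_setT.
apply: ae_ge0_le_integral => //.
have := hT0; rewrite /positive_rv.
apply: filterS => w Tw _; rewrite lee_fin -expR0 ler_expR.
by rewrite mulNr oppr_le0 mulr_ge0// ltW.
Qed.

(** By [laplace_gt0] and [laplace_le1], neither [fine] nor [ln] loses
    information in the definition of the cumulant. *)
Lemma laplaceE s : 0 <= s -> laplace s = (expR (- cumulant T0 s))%:E.
Proof.
move=> s0; have l0 := laplace_gt0 s; have l1 := laplace_le1 s0.
have lfin : laplace s \is a fin_num.
  by rewrite ge0_fin_numE ?(ltW l0)// (le_lt_trans l1)// ltry.
rewrite /cumulant opprK -/(laplace s) lnK ?fineK//.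
by rewrite posrE fine_gt0// l0 (le_lt_trans l1)// ltry.
Qed.

Context (f : R -> R) (hf : has_density (distribution P0 T0) f).

(** What makes the conventional values of powers at [t <= 0] harmless in all the
    integrals against [f]. *)
Lemma density_pos_support : {ae leb, forall t, 0 < t \/ f t = 0}.
Proof.
have [mf f0 muE] := hf.
have mD : measurable (`]-oo, 0] : set R) by [].
have D0 : distribution P0 T0 `]-oo, 0] = 0%E.
  case: hT0 => N [mN N0 subN]; apply: (subset_measure0 _ _ _ N0) => //.
    exact: measurable_funPTI.
  apply: subset_trans subN => w /=; rewrite in_itv/= => Tw.
  by apply/negP; rewrite -leNgt.
move: D0; rewrite muE// => D0.
have mg : measurable_fun (`]-oo, 0]%classic : set R) (EFin \o f).
  exact/measurable_EFinP/measurable_funTS.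
have := ae_eq_integral_abs leb mD mg.
under eq_integral do rewrite gee0_abs ?lee_fin//.
move=> [/(_ D0) H _]; apply: filterS H => t /= H.
have [t0|t0] := ltP 0 t; [by left|right].
by move: H; rewrite in_itv/= => /(_ t0)[].
Qed.

Lemma measurable_exp_tilt : measurable_fun [set: R * R]
  (fun z => exp_tilt_pdf T0 f z.1 z.2).
Proof.
have [mf f0 muE] := hf.
apply: measurable_funM; last exact: measurableT_comp.
apply: measurableT_comp => //; apply: measurable_funD.
  by apply: measurable_funM => //; exact: measurableT_comp.
exact: measurableT_comp measurable_cumulant _.
Qed.

Lemma exp_tilt_ge0 s t : 0 <= exp_tilt_pdf T0 f s t.
Proof. by case: hf => _ f0 _; rewrite mulr_ge0 ?expR_ge0. Qed.

Lemma integral_exp_tilt s : 0 <= s ->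
  (\int[leb]_t (exp_tilt_pdf T0 f s t)%:E = 1)%E.
Proof.
move=> s0; have [mf f0 muE] := hf.
have ms : measurable_fun [set: R] (fun t => (expR (- s * t))%:E).
  by apply/measurable_EFinP/measurableT_comp => //; exact: measurable_funM.
transitivity ((expR (cumulant T0 s))%:E * laplace s)%E; last first.
  by rewrite laplaceE// -EFinM -expRD subrr expR0.
rewrite /laplace unlock.
have -> : (\int[P0]_w (expR (- s * T0 w))%:E =
    \int[distribution P0 T0]_t (expR (- s * t))%:E)%E.
  by rewrite ge0_integral_distribution.
rewrite (ge0_integral_has_density hf)//.
rewrite -ge0_integralZl//.
- apply: eq_integral => t _.
  by rewrite -!EFinM /exp_tilt_pdf expRD mulrA [_ * expR (cumulant _ _)]mulrC.
- by apply: emeasurable_funM => //; exact/measurable_EFinP.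
- by move=> t _; rewrite -EFinM lee_fin mulr_ge0 ?expR_ge0.
Qed.

End tilt.

(** * Change of variables between the two descriptions *)

Section mixture_identity.
Context {R : realType} (nu : R) (d0 : measure_display)
  (Omega0 : measurableType d0) (P0 : probability Omega0 R) (T0 : {RV P0 >-> R})
  (f : R -> R).
Context (hT0 : positive_rv T0) (hf : has_density (distribution P0 T0) f).
Local Notation leb := (@lebesgue_measure R).

Lemma Gamma_fun_ge0 : 0 <= Gamma_fun nu.
Proof.
by apply: Rintegral_ge0 => x _; rewrite mulr_ge0 ?powR_ge0 ?expR_ge0.
Qed.

Lemma neg_moment_ge0 : 0 <= fine (neg_moment T0 nu).
Proof. by apply/fine_ge0/expectation_ge0 => w; exact: powR_ge0. Qed.

Lemma Gamma_pdf_ge0 x : 0 <= Gamma_pdf nu x.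
Proof.
rewrite /Gamma_pdf patchE; case: ifP => // _.
by rewrite divr_ge0 ?Gamma_fun_ge0 ?mulr_ge0 ?powR_ge0 ?expR_ge0.
Qed.

Lemma measurable_Gamma_pdf : measurable_fun [set: R] (Gamma_pdf nu).
Proof.
apply/measurable_restrict => //=; rewrite setTI; apply: measurable_funTS.
apply: measurable_funM => //; apply: measurable_funM => //.
by apply: measurableT_comp => //; exact: measurableT_comp.
Qed.

Lemma mixing_pdf_ge0 x : 0 <= mixing_pdf T0 nu x.
Proof.
rewrite /mixing_pdf patchE; case: ifP => // _.
by rewrite divr_ge0 ?mulr_ge0 ?neg_moment_ge0 ?Gamma_fun_ge0 ?powR_ge0//
  ?expR_ge0.
Qed.

Lemma measurable_mixing_pdf : measurable_fun [set: R] (mixing_pdf T0 nu).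
Proof.
apply/measurable_restrict => //=; rewrite setTI; apply: measurable_funTS.
apply: measurable_funM => //; apply: measurable_funM => //.
by do 2 apply: measurableT_comp => //; exact: measurable_cumulant.
Qed.

Lemma poly_tilt_ge0 x : 0 <= poly_tilt_pdf T0 f nu x.
Proof.
case: hf => _ f0 _.
by rewrite /poly_tilt_pdf mulr_ge0 ?divr_ge0 ?neg_moment_ge0 ?powR_ge0.
Qed.

Lemma measurable_poly_tilt : measurable_fun [set: R] (poly_tilt_pdf T0 f nu).
Proof.
case: hf => mf _ _; apply: measurable_funM => //.
by apply: measurable_funM => //; exact: measurable_powR.
Qed.

(** The joint density of [(xi, T)] at [(s, t)], computed in two ways: from the
    product law of [(T, xi * T)], where the factor [t] is the Jacobian of
    [s |-> t * s], and from the mixture of exponential tilts. The powers of [t]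
    cancel because [1 + (nu - 1) - nu = 0], and the mixing density undoes the
    factor [expR (cumulant T0 s)] that normalises the tilt. *)
Lemma Gamma_poly_tiltE (s t : R) : 0 < t ->
  t * Gamma_pdf nu (t * s) * poly_tilt_pdf T0 f nu t =
  mixing_pdf T0 nu s * exp_tilt_pdf T0 f s t.
Proof.
move=> t0; rewrite /Gamma_pdf /mixing_pdf !patchE.
have -> : (t * s \in `]0, +oo[%classic) = (s \in `]0, +oo[%classic).
  by rewrite !mem_setE !in_itv/= !andbT pmulr_rgt0.
case: ifPn => [|_]; last by rewrite mulr0 !mul0r.
rewrite inE/= in_itv/= andbT => s0.
rewrite /poly_tilt_pdf /exp_tilt_pdf powRM ?(ltW s0) ?(ltW t0)//.
have E1 : t * t `^ (nu - 1) * t `^ (- nu) = 1.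
  rewrite -[X in X * _ * _](powRr1 (ltW t0)) -!powRD ?(gt_eqF t0) ?implybT//.
  by rewrite [1 + _]addrC subrK subrr powRr0.
have E2 : expR (- cumulant T0 s) * expR (cumulant T0 s) = 1.
  by rewrite -expRD addNr expR0.
rewrite expRD [- s * t]mulNr [s * t]mulrC invfM.
set G := (Gamma_fun nu)^-1; set m := (fine _)^-1; set e := expR (- (t * s)).
transitivity (s `^ (nu - 1) * G * m * e * f t *
  (t * t `^ (nu - 1) * t `^ (- nu))); first by ring.
rewrite E1 -E2; ring.
Qed.

(** [Gamma_poly_tiltE] integrated over the rectangle: Tonelli's theorem on the
    right, the substitution [y = t * s] on the left. The quotient [y / t] is
    written [y * t `^ (-1)], which is jointly measurable as a power function;
    the two coincide for [0 < t], the only range that [f] charges. *)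
Lemma mixture_identity (A B : set R) : measurable A -> measurable B ->
  (\int[leb]_(t in B) ((\int[leb]_(y in (fun y => (y * t `^ (-1))%R) @^-1` A)
     (Gamma_pdf nu y)%:E) * (poly_tilt_pdf T0 f nu t)%:E) =
   \int[leb]_(s in A) ((mixing_pdf T0 nu s)%:E *
     \int[leb]_(t in B) (exp_tilt_pdf T0 f s t)%:E))%E.
Proof.
move=> mA mB.
have mexp := measurable_exp_tilt hf.
have mGam := measurable_Gamma_pdf.
have mmix := measurable_mixing_pdf.
have mpol := measurable_poly_tilt.
have mexps s : measurable_fun [set: R] (exp_tilt_pdf T0 f s).
  exact: (measurableT_comp mexp (pair1_measurable s)).
have mexpsE s : measurable_fun [set: R] (EFin \o exp_tilt_pdf T0 f s).
  exact/measurable_EFinP.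
transitivity (\int[leb]_(s in A) \int[leb]_(t in B)
    (mixing_pdf T0 nu s * exp_tilt_pdf T0 f s t)%:E)%E; last first.
  apply: eq_integral => s _; rewrite -ge0_integralZl//.
  - exact: measurable_funTS (mexpsE s).
  - by move=> t _; rewrite lee_fin (exp_tilt_ge0 hf).
  - by rewrite lee_fin mixing_pdf_ge0.
pose h s t := (mixing_pdf T0 nu s * exp_tilt_pdf T0 f s t)%:E.
have mh : measurable_fun [set: R * R] (fun z => h z.1 z.2).
  by apply/measurable_EFinP/measurable_funM => //; exact: measurableT_comp.
have h0 s t : (0 <= h s t)%E.
  by rewrite lee_fin mulr_ge0 ?mixing_pdf_ge0 ?(exp_tilt_ge0 hf).
rewrite (ge0_integral_exchange mA mB mh h0).
pose g t y := (Gamma_pdf nu y * \1_A (y * t `^ (-1)))%:E.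
have mg : measurable_fun [set: R * R] (fun z => g z.1 z.2).
  apply/measurable_EFinP/measurable_funM; first exact: measurableT_comp.
  apply: (measurableT_comp (measurable_indic mA)).
  apply: measurable_funM => //.
  exact: (measurableT_comp (measurable_powR (-1)) measurable_fst).
have g0 t y : (0 <= g t y)%E by rewrite lee_fin mulr_ge0 ?Gamma_pdf_ge0.
have gE t : (\int[leb]_(y in (fun y => (y * t `^ (-1))%R) @^-1` A)
     (Gamma_pdf nu y)%:E = \int[leb]_y g t y)%E.
  rewrite integral_mkcond; apply: eq_integral => y _.
  rewrite patchE /g indicE.
  have -> : (y \in (fun y => y * t `^ (-1)) @^-1` A) = (y * t `^ (-1) \in A).
    by apply/idP/idP; rewrite !inE.
  by case: ifP; rewrite ?mulr1 ?mulr0.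
under eq_integral do rewrite gE.
apply: ge0_ae_eq_integral => //.
- apply: measurable_funTS; apply: emeasurable_funM.
    exact: measurable_fun_ge0_integral.
  exact/measurable_EFinP.
- apply: measurable_funTS.
  apply: (measurable_fun_ge0_integral (h := fun t s => h s t)) => //.
  exact: (measurableT_comp mh
    (measurable_fun_pair measurable_snd measurable_fst)).
- move=> t _; rewrite mule_ge0 ?lee_fin ?poly_tilt_ge0//.
  exact: integral_ge0.
- by move=> t _; exact: integral_ge0.
apply: (@filterS _ _ (ae_filter_ringOfSetsType leb) _ _ _
  (density_pos_support hT0 hf)) => t [t0|ft0] _; last first.
  rewrite /poly_tilt_pdf ft0 mulr0 mule0.
  by rewrite integral0_eq// => s _; rewrite /h /exp_tilt_pdf ft0 !mulr0.
have mgt : measurable_fun [set: R] (g t).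
  exact: (measurableT_comp mg (pair1_measurable t)).
rewrite (ge0_integral_scale t0 mgt)//.
rewrite [RHS]integral_mkcond muleAC -ge0_integralZl//; first last.
- by rewrite -EFinM lee_fin mulr_ge0 ?poly_tilt_ge0// ltW.
- have mt : measurable_fun [set: R] ( *%R t) by exact: measurable_funM.
  exact: measurableT_comp mgt mt.
apply: eq_integral => s _.
rewrite patchE /g/= powR_inv1 ?(ltW t0)// [t * s]mulrC mulfK ?gt_eqF//.
rewrite indicE; case: ifP => _; last by rewrite mulr0 mule0.
by rewrite -!EFinM mulr1 mulrAC [s * t]mulrC Gamma_poly_tiltE.
Qed.

End mixture_identity.

(** * Laws of pairs *)

(** Rectangles are stable under intersection and generate the product
    sigma-algebra. *)
Lemma measure_eq_rectangles (R : realType)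
    (m1 m2 : {measure set (R * R) -> \bar R}) :
  m1 setT = 1%E ->
  (forall A B, measurable A -> measurable B -> m1 (A `*` B) = m2 (A `*` B)) ->
  forall X : set (R * R), measurable X -> m1 X = m2 X.
Proof.
move=> m1T m12 X mX.
apply: (measure_unique [set A `*` B | A in measurable & B in measurable]
  (fun=> setT)) => //.
- by rewrite measurable_prod_measurableType.
- move=> _ _ [A mA [B mB <-]] [C mC [D mD <-]]; rewrite -setXI.
  exists (A `&` C); first exact: measurableI.
  by exists (B `&` D) => //; exact: measurableI.
- by move=> _; exists setT => //; exists setT => //; rewrite setXTT.
- by rewrite bigcup_const.
- by move=> _ [A mA [B mB <-]]; exact: m12.
- by move=> _; rewrite m1T ltry.
Qed.

Lemma measure_setI_full {R : realType} d (T : measurableType d)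
    (mu : {measure set T -> \bar R}) (D A : set T) :
  measurable D -> measurable A -> mu (~` D) = 0%E -> mu A = mu (A `&` D).
Proof.
move=> mD mA D0; rewrite -{1}(setUIDK A D) measureU//.
- rewrite [X in (_ + X)%E](_ : _ = 0%E) ?adde0//.
  apply: (subset_measure0 _ _ _ D0) => //.
  + exact: measurableD.
  + exact: measurableC.
- exact: measurableI.
- exact: measurableD.
- by rewrite setDE setIACA setICr setI0.
Qed.

Section pair.
Context {R : realType} d (Omega : measurableType d) (P : probability Omega R)
  (X Y : {RV P >-> R}).

Definition pair_rv (w : Omega) : R * R := (X w, Y w).

Let measurable_pair_rv : measurable_fun [set: Omega] pair_rv.
Proof. exact: measurable_fun_pair. Qed.

HB.instance Definition _ :=
  isMeasurableFun.Build _ _ _ _ pair_rv measurable_pair_rv.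

Lemma independent_pair_law : independent_rv X Y ->
  forall E, measurable E ->
  P (pair_rv @^-1` E) = (distribution P X \x distribution P Y)%E E.
Proof.
move=> XY E mE; symmetry.
exact: (@product_measure_unique _ _ _ _ _ (distribution P X)
  (distribution P Y) (distribution P pair_rv)).
Qed.

Context (Xpos : positive_rv X).

Lemma positive_rv_setI (B : set R) (E : set Omega) :
  measurable B -> measurable E ->
  P (X @^-1` B `&` E) = P (X @^-1` (B `&` `]0, +oo[) `&` E).
Proof.
move=> mB mE.
have mX C : measurable C -> measurable (X @^-1` C).
  by move=> mC; exact: measurable_funPTI.
rewrite (measure_setI_full (D := X @^-1` `]0, +oo[)).
- by rewrite preimage_setI setIAC.
- exact: mX.
- by apply: measurableI => //; exact: mX.
- case: Xpos => N [mN N0 subN]; apply: (subset_measure0 _ _ _ N0) => //.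
    by apply: measurableC; exact: mX.
  by apply: subset_trans subN => w /=; rewrite in_itv/= andbT.
Qed.

End pair.

(** * The joint law of the pair *)

Section joint_law.
Context {R : realType} (nu : R) (d0 : measure_display)
  (Omega0 : measurableType d0) (P0 : probability Omega0 R) (T0 : {RV P0 >-> R})
  (f : R -> R).
Context (hT0 : positive_rv T0) (hf : has_density (distribution P0 T0) f).
Local Notation leb := (@lebesgue_measure R).

(** The mass of the rectangle [A * B] under the law of density
    [(s, t) |-> mixing_pdf T0 nu s * exp_tilt_pdf T0 f s t]. *)
Definition tilted_joint (A B : set R) : \bar R :=
  (\int[leb]_(s in A) ((mixing_pdf T0 nu s)%:E *
     \int[leb]_(t in B) (exp_tilt_pdf T0 f s t)%:E))%E.

(** Turns [(T, xi * T)] into [(xi, T)]. *)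
Definition ratio (z : R * R) : R * R := (z.2 * z.1 `^ (-1), z.1).

Lemma measurable_ratio : measurable_fun [set: R * R] ratio.
Proof.
apply: measurable_fun_pair => //; apply: measurable_funM => //.
exact: (measurableT_comp (measurable_powR (-1)) measurable_fst).
Qed.

(** The mass of the rectangle is computed by slicing along the first
    coordinate of the product; [mixture_identity] evaluates the result. *)
Lemma product_ratio (muT muY : probability R R) (A B : set R) :
  has_density muT (poly_tilt_pdf T0 f nu) -> has_density muY (Gamma_pdf nu) ->
  measurable A -> measurable B ->
  (muT \x muY)%E (ratio @^-1` (A `*` B)) = tilted_joint A B.
Proof.
move=> dT dY mA mB; rewrite /tilted_joint -(mixture_identity _ hT0 hf)//.
pose E := ratio @^-1` (A `*` setT).
have mE : measurable E.
  rewrite -[E]setTI; apply: measurable_ratio => //; exact: measurableX.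
have Ex t : xsection E t = (fun y => y * t `^ (-1)) @^-1` A.
  by apply/seteqP; split => y; rewrite /xsection/= inE /E/=; [case|].
have -> : (muT \x muY)%E (ratio @^-1` (A `*` B)) =
    (\int[muT]_(t in B) muY (xsection E t))%E.
  rewrite [RHS]integral_mkcond; apply: eq_integral => t _ /=.
  rewrite patchE; case: ifPn => tB.
    congr (muY _); apply/seteqP; split => y; rewrite /xsection/= !inE /E/=.
      by case.
    by case => ? _; split => //; exact: set_mem.
  rewrite -[RHS](measure0 muY); congr (muY _); apply/seteqP; split => y //.
  by rewrite /xsection/= inE/= => -[_ /mem_set]; rewrite (negbTE tB).
rewrite (ge0_integral_has_density dT)//; last exact: measurable_fun_xsection.
apply: eq_integral => t _; congr (_ * _)%E.
have [_ _ ->] := dY; first by rewrite Ex.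
exact: measurable_xsection.
Qed.

Section random_pair.
Context d (Omega : measurableType d) (P : probability Omega R)
  (xi T : {RV P >-> R}).
Context (hT : positive_rv T).

Let mpre (X : {RV P >-> R}) A : measurable A -> measurable (X @^-1` A).
Proof. by move=> mA; exact: measurable_funPTI. Qed.

Definition has_tilted_joint := forall A B, measurable A -> measurable B ->
  P (xi @^-1` A `&` T @^-1` B) = tilted_joint A B.

(** Independence says that [(T, xi * T)] follows a product law, whose image by
    [ratio] is the law of [(xi, T)]. *)
Lemma independent_tilted_joint :
  independent_rv T (xi \* T) ->
  has_density (distribution P (xi \* T)) (Gamma_pdf nu) ->
  has_density (distribution P T) (poly_tilt_pdf T0 f nu) ->
  has_tilted_joint.
Proof.
move=> ind dY dT A B mA mB.
have mratio D : measurable D -> measurable (ratio @^-1` D).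
  by move=> mD; rewrite -[X in measurable X]setTI; exact: measurable_ratio.
rewrite -(product_ratio dT dY mA mB) -independent_pair_law//; last first.
  by apply: mratio; exact: measurableX.
rewrite setIC (positive_rv_setI hT)//; last exact: mpre.
pose E := pair_rv T (xi \* T) @^-1` (ratio @^-1` (A `*` setT)).
have mE : measurable E.
  by apply: measurable_funPTI; apply: mratio; exact: measurableX.
have -> : pair_rv T (xi \* T) @^-1` (ratio @^-1` (A `*` B)) = T @^-1` B `&` E.
  by apply/seteqP; split => w; rewrite /E /pair_rv /ratio/= => -[] // Bw [].
rewrite [RHS](positive_rv_setI hT)//.
have ratioK w : 0 < T w -> xi w * T w * T w `^ (-1) = xi w.
  by move=> Tw; rewrite powR_inv1 ?ltW// mulfK// gt_eqF.
congr (P _); apply/seteqP; split => w /= [[Bw]]; rewrite in_itv/= andbT => Tw.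
  by rewrite /E /pair_rv /ratio/= ratioK// => Aw; split.
by rewrite /E /pair_rv /ratio/= ratioK// => -[Aw _]; split.
Qed.

Lemma tilted_joint_density : has_tilted_joint ->
  has_density (distribution P xi) (mixing_pdf T0 nu).
Proof.
move=> J; split.
- exact: measurable_mixing_pdf.
- exact: mixing_pdf_ge0.
- move=> A mA; have := J A setT mA measurableT.
  rewrite preimage_setT setIT => JA; rewrite [LHS]JA.
  apply: eq_integral => s _.
  have [s0|s0] := leP 0 s; first by rewrite (integral_exp_tilt hT0 hf)// mule1.
  rewrite /mixing_pdf patchE memNset ?mul0e//= in_itv/= andbT.
  by apply/negP; rewrite -leNgt ltW.
Qed.

(** The tilts at [`|s|] complete those at [0 < s] to a kernel on the whole line
    without any case distinction. *)
Lemma tilted_joint_conditional : has_tilted_joint ->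
  exists kappa : R.-pker R ~> R,
    regular_conditional_law T xi kappa /\
    {ae leb, forall s : R, 0 < s ->
       has_density (kappa s) (exp_tilt_pdf T0 f s)}.
Proof.
move=> J; have dxi := tilted_joint_density J.
have [||s|kappa dk] := @exists_density_kernel R
  (fun s t => exp_tilt_pdf T0 f `|s| t).
- apply: (measurableT_comp (measurable_exp_tilt hf)
    (g := fun z : R * R => (`|z.1|, z.2))).
  by apply: measurable_fun_pair => //; exact: measurableT_comp.
- by move=> s t; exact: exp_tilt_ge0 hf _ _.
- exact: integral_exp_tilt.
exists kappa; split; last first.
  apply: aeW => s s0; have := dk s.
  by rewrite gtr0_norm.
move=> A B mA mB; rewrite J//.
rewrite (ge0_integral_has_density dxi)//; last exact: measurable_kernel.
apply: eq_integral => s _; rewrite muleC.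
have [s0|s0] := ltP 0 s.
  have [_ _ /(_ B mB) kE] := dk s; rewrite kE.
  by rewrite (gtr0_norm s0).
have -> : mixing_pdf T0 nu s = 0.
  rewrite /mixing_pdf patchE memNset//= in_itv/= andbT.
  by apply/negP; rewrite -leNgt.
by rewrite !mule0.
Qed.

Lemma conditional_tilted_joint (kappa : R.-pker R ~> R) :
  has_density (distribution P xi) (mixing_pdf T0 nu) ->
  regular_conditional_law T xi kappa ->
  {ae leb, forall s : R, 0 < s ->
     has_density (kappa s) (exp_tilt_pdf T0 f s)} ->
  has_tilted_joint.
Proof.
move=> dxi reg dk A B mA mB; rewrite reg//.
rewrite (ge0_integral_has_density dxi)//; last exact: measurable_kernel.
have mI : measurable_fun [set: R]
    (fun s => \int[leb]_(t in B) (exp_tilt_pdf T0 f s t)%:E)%E.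
  apply: (measurable_fun_ge0_integral
    (h := fun s t => (exp_tilt_pdf T0 f s t)%:E)) => //.
    by apply/measurable_EFinP; exact: measurable_exp_tilt hf.
  by move=> s t; rewrite lee_fin (exp_tilt_ge0 hf).
have mm : measurable_fun [set: R] (EFin \o mixing_pdf T0 nu).
  by apply/measurable_EFinP; exact: measurable_mixing_pdf.
apply: ge0_ae_eq_integral => //.
- apply: measurable_funTS; apply: emeasurable_funM => //.
  exact: (measurable_kernel kappa B mB).
- by apply: measurable_funTS; apply: emeasurable_funM.
- by move=> s _; rewrite mule_ge0// lee_fin mixing_pdf_ge0.
- move=> s _; rewrite mule_ge0 ?lee_fin ?mixing_pdf_ge0//.
  by apply: integral_ge0 => t _; rewrite lee_fin (exp_tilt_ge0 hf).
apply: (@filterS _ _ (ae_filter_ringOfSetsType leb) _ _ _ dk) => s dks _.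
rewrite muleC; have [s0|s0] := ltP 0 s.
  by have [_ _ /(_ B mB) kE] := dks s0; rewrite kE.
have -> : mixing_pdf T0 nu s = 0.
  rewrite /mixing_pdf patchE memNset//= in_itv/= andbT.
  by apply/negP; rewrite -leNgt.
by rewrite !mul0e.
Qed.

(** If [Gamma_fun nu] were zero, so would be the mixing density, whose total
    mass is one. Being nonzero, this constant is not the [fine] part of an
    infinite integral: the Gamma integral converges. *)
Lemma tilted_joint_Gamma1 : has_tilted_joint ->
  (\int[leb]_y (Gamma_pdf nu y)%:E = 1)%E.
Proof.
move=> /(_ setT setT measurableT measurableT).
rewrite !preimage_setT setIT probability_setT /tilted_joint.
rewrite -(mixture_identity _ hT0 hf)// => J.
have G0 : Gamma_fun nu != 0.
  apply/eqP => G0; move: J; rewrite integral0_eq ?oner_eq0//.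
    by move=> /eqP; rewrite onee_eq0.
  move=> t _; rewrite integral0_eq ?mul0e// => y _.
  by rewrite /Gamma_pdf patchE G0 invr0 mulr0 if_same.
have mg : measurable_fun (`]0, +oo[%classic : set R)
    (fun x : R => (x `^ (nu - 1) * expR (- x))%:E).
  apply/measurable_EFinP; apply: measurable_funTS.
  apply: measurable_funM; first exact: measurable_powR.
  by apply: measurableT_comp => //; exact: measurableT_comp.
have g0 (x : R) : (0 <= (x `^ (nu - 1) * expR (- x))%:E)%E.
  by rewrite lee_fin mulr_ge0 ?powR_ge0 ?expR_ge0.
transitivity ((\int[leb]_(x in `]0%R, +oo[) (x `^ (nu - 1) * expR (- x))%:E) *
  (Gamma_fun nu)^-1%:E)%E.
  rewrite -ge0_integralZr//; last by rewrite lee_fin invr_ge0 Gamma_fun_ge0.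
  rewrite [RHS]integral_mkcond; apply: eq_integral => y _.
  by rewrite /Gamma_pdf !patchE; case: ifP.
have := G0; rewrite /Gamma_fun /Rintegral.
set I := (\int[leb]_(x in _) _)%E => I0.
have Ifin : I \is a fin_num by move: I0; case: I => //=; rewrite eqxx.
by rewrite -{1}(fineK Ifin) -EFinM mulfV.
Qed.

(** In the slice formula of [mixture_identity] the full slices have unit Gamma
    mass, so that only the polynomial tilt remains. *)
Lemma tilted_joint_poly_density : has_tilted_joint ->
  has_density (distribution P T) (poly_tilt_pdf T0 f nu).
Proof.
move=> J; have G1 := tilted_joint_Gamma1 J; split.
- exact: measurable_poly_tilt hf.
- exact: poly_tilt_ge0 hf.
- move=> B mB; have := J setT B measurableT mB.
  rewrite preimage_setT setTI /tilted_joint -(mixture_identity _ hT0 hf)//.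
  move=> JB; rewrite [LHS]JB; apply: eq_integral => t _.
  by rewrite preimage_setT G1 mul1e.
Qed.

(** The law of [(xi, T)] and the image by [ratio] of the product of the law of
    [T] and the Gamma law agree on rectangles by [product_ratio], hence
    everywhere; undoing [ratio] on [0 < T] gives the law of [(T, xi * T)]. *)
Lemma tilted_joint_product : has_tilted_joint ->
  exists2 gam : probability R R, has_density gam (Gamma_pdf nu) &
  forall B C, measurable B -> measurable C ->
    P (T @^-1` B `&` (xi \* T) @^-1` C) = (P (T @^-1` B) * gam C)%E.
Proof.
move=> J; have G1 := tilted_joint_Gamma1 J.
have dT := tilted_joint_poly_density J.
have [gam dgam] := exists_probability_density (measurable_Gamma_pdf nu)
  (Gamma_pdf_ge0 nu) G1.
exists gam => // B C mB mC.
have mmul : measurable_fun [set: R * R] (fun z : R * R => z.1 * z.2).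
  exact: measurable_funM.
pose phi : {mfun (R * R)%type >-> (R * R)%type} :=
  HB.pack ratio (isMeasurableFun.Build _ _ _ _ _ measurable_ratio).
have LN E : measurable E -> distribution P (pair_rv xi T) E =
    distribution (distribution P T \x gam)%E phi E.
  apply: measure_eq_rectangles; first exact: probability_setT.
  by move=> A D mA mD; rewrite [RHS](product_ratio dT dgam)// -J.
rewrite (positive_rv_setI hT)//; last exact: mpre.
have -> : P (T @^-1` B) = P (T @^-1` (B `&` `]0, +oo[)).
  by have := positive_rv_setI hT mB measurableT; rewrite !setIT.
set B' := B `&` _.
have mB' : measurable B' by exact: measurableI.
pose E : set (R * R) := snd @^-1` B' `&` (fun z => z.1 * z.2) @^-1` C.
have mE : measurable E.
  apply: measurableI; rewrite -[X in measurable X]setTI.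
    exact: measurable_snd.
  exact: (mmul measurableT C mC).
have phiE : phi @^-1` E = B' `*` C.
  have ratioK (t y : R) : 0 < t -> y * t `^ (-1) * t = y.
    by move=> t0; rewrite powR_inv1 ?ltW// mulfVK// gt_eqF.
  have B'_gt0 t : B' t -> 0 < t.
    by case=> _ /=; rewrite in_itv/= andbT.
  apply/seteqP; split => -[t y] [] /= B't Cy; split => //=.
    by move: Cy; rewrite /= ratioK//; exact: B'_gt0.
  by rewrite ratioK//; exact: B'_gt0.
transitivity (distribution P (pair_rv xi T) E); first by [].
rewrite LN//.
transitivity ((distribution P T \x gam)%E (phi @^-1` E)); first by [].
by rewrite phiE product_measure1E.
Qed.

End random_pair.
End joint_law.

Theorem theorem1 (R : realType) (nu : R) (hnu : 0 < nu)
  (d0 : measure_display) (Omega0 : measurableType d0)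
  (P0 : probability Omega0 R) (T0 : {RV P0 >-> R}) (f : R -> R)
  (hT0 : positive_rv T0) (hf : has_density (distribution P0 T0) f)
  (hmom : (neg_moment T0 nu < +oo)%E)
  (d : measure_display) (Omega : measurableType d)
  (P : probability Omega R) (xi T : {RV P >-> R})
  (hxi : positive_rv xi) (hT : positive_rv T)
  (acxi : abs_continuous_rv xi) (acT : abs_continuous_rv T) :
  [/\ independent_rv T (xi \* T),
      has_density (distribution P (xi \* T)) (Gamma_pdf nu) &
      has_density (distribution P T) (poly_tilt_pdf T0 f nu)]
  <->
  has_density (distribution P xi) (mixing_pdf T0 nu) /\
  (exists kappa : R.-pker R ~> R,
    regular_conditional_law T xi kappa /\
    {ae lebesgue_measure, forall s : R, 0 < s ->
       has_density (kappa s) (exp_tilt_pdf T0 f s)}).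
Proof.
split=> [[ind dY dT]|[dxi [kappa [reg dk]]]].
  have J := independent_tilted_joint hT0 hf hT ind dY dT.
  split; first exact: (tilted_joint_density hT0 hf J).
  exact: (tilted_joint_conditional hT0 hf J).
have J := conditional_tilted_joint hf dxi reg dk.
have [gam dgam TYE] := tilted_joint_product hT0 hf hT J.
have YE C : measurable C -> P ((xi \* T) @^-1` C) = gam C.
  move=> mC; have := TYE setT C measurableT mC.
  by rewrite preimage_setT setTI probability_setT mul1e.
split.
- by move=> B C mB mC; rewrite TYE// YE.
- have [mG G0 gamE] := dgam; split => // C mC.
  by rewrite [LHS]YE// gamE.
- exact: (tilted_joint_poly_density hT0 hf J).
Qed.
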